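(* Let $m$ be a positive integer and let $A_m=(a_{ki})_{k,i=1}^m$ be a real skew-symmetric matrix with $a_{ki}\in[-1,1]$ for all $k,i$. Assume $A_m$ is transversal, i.e. all principal minors of $A_m$ of even order are nonzero. Let $V:S^{m-1}\to S^{m-1}$ be the corresponding quadratic stochastic Volterra operator $$(Vx)_k = x_k\left(1+\sum_{i=1}^m a_{ki}x_i\right),\qquad k=1,\dots,m,$$ on the simplex $S^{m-1}=\{x\in\mathbb{R}^m:\ \sum_{i=1}^m x_i=1,\ x_i\ge 0 \text{ for all } i\}$. Then the following statements are equivalent: (i) $V$ is regular; (ii) $V$ is transitive; (iii) $V$ satisfies the Ergodic principle; (iv) $\lim_{n\to\infty}\|V^n x-V^{n+1}x\|=0$ for every $x\in S^{m-1}$.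
   Context: Notation: $\|x\|=\sqrt{\sum_{i=1}^m x_i^2}$ is the Euclidean norm on $\mathbb{R}^m$, and $V^n$ denotes the $n$-fold composition of $V$ with itself. For $x\in S^{m-1}$, $\mathrm{supp}(x)=\{i: x_i\neq 0\}$. Quadratic stochastic Volterra operators: a quadratic stochastic operator is a map $V:S^{m-1}\to S^{m-1}$ of the form $(Vx)_k=\sum_{i,j=1}^m P_{ij,k}x_ix_j$ with $P_{ij,k}=P_{ji,k}\ge 0$ and $\sum_{k=1}^m P_{ij,k}=1$ for all $i,j$. It is called Volterra if $P_{ij,k}=0$ whenever $k\notin\{i,j\}$. Any such operator can be written as $(Vx)_k=x_k(1+\sum_{i=1}^m a_{ki}x_i)$ with $(a_{ki})$ skew-symmetric and $a_{ki}\in[-1,1]$. Transversality: a skew-symmetric matrix $A_m$ is transversal if all its even-order principal minors (determinants of the submatrices with rows and columns indexed by the same subset of $\{1,\dots,m\}$ of even nonzero cardinality) are nonzero; $V$ is transversal if its matrix $A_m$ is. In particular, transversality gives $a_{ij}\neq 0$ for all $i\neq j$. Regular: $V$ is regular if for every $x\in S^{m-1}$ the trajectory $(V^n x)_{n\ge 0}$ converges to some fixed point of $V$ (the limit may depend on $x$). Transitive: a tournament is a complete directed graph (exactly one directed edge between each pair of distinct vertices); it is transitive if it contains no directed cycle of length 3. To a transversal $V$ associate the tournament $T_m$ on the vertices $1,\dots,m$ in which, for $i\neq j$, the edge is directed from $i$ to $j$ if $a_{ij}<0$ and from $j$ to $i$ otherwise. $V$ is transitive if $T_m$ is transitive. Ergodic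 principle: $V$ satisfies the Ergodic principle (on $S^{m-1}$) if for all $x,y\in S^{m-1}$ with $\mathrm{supp}(x)=\mathrm{supp}(y)$ one has $\lim_{n\to\infty}\|V^n x-V^n y\|=0$. *)

(* Defs.v *)
From HB Require Import structures.
From mathcomp Require Import all_boot all_order all_algebra.
From mathcomp Require Import all_classical all_reals all_analysis.
From mathcomp Require Import ring.

Set Implicit Arguments.
Unset Strict Implicit.
Unset Printing Implicit Defensive.

Import Order.TTheory GRing.Theory Num.Theory.
Import numFieldNormedType.Exports.

Local Open Scope classical_set_scope.
Local Open Scope ring_scope.

Section Simplex.
Context {R : realType} {m : nat}.
Implicit Types (x y p : 'rV[R]_m) (V : 'rV[R]_m -> 'rV[R]_m).

Definition simplex : set 'rV[R]_m :=
  [set x | \sum_i x 0 i = 1 /\ forall i, 0 <= x 0 i].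

(* The library norm on matrices is the sup norm, hence this definition. *)
Definition euclidean_norm x : R := Num.sqrt (\sum_i x 0 i ^+ 2).

Definition supp x : {set 'I_m} := [set i | x 0 i != 0].

(* An operator on the simplex is represented by a map on the whole space; the
   properties below only look at its values on the simplex, which the operators
   of interest preserve (see [volterra_simplex]). *)

Definition regular V : Prop :=
  forall x, simplex x ->
    exists p, [/\ simplex p, V p = p & iter n V x @[n --> \oo] --> p].

Definition ergodic_principle V : Prop :=
  forall x y, simplex x -> simplex y -> supp x = supp y ->
    euclidean_norm (iter n V x - iter n V y) @[n --> \oo] --> (0 : R).

Definition asymptotically_regular V : Prop :=
  forall x, simplex x ->
    euclidean_norm (iter n V x - iter n.+1 V x) @[n --> \oo] --> (0 : R).

End Simplex.

Section Volterra.
Context {R : realType} {m : nat}.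
Implicit Types A : 'M[R]_m.

Definition volterra A (x : 'rV[R]_m) : 'rV[R]_m :=
  \row_k (x 0 k * (1 + \sum_i A k i * x 0 i)).

Definition skew_symmetric A : Prop := A^T = - A.

Definition principal_minor A (I : {set 'I_m}) : R :=
  \det (mxsub (fun i : 'I_#|I| => enum_val i) (fun i : 'I_#|I| => enum_val i) A).

Definition transversal_mx A : Prop :=
  forall I : {set 'I_m}, I != finset.set0 -> ~~ odd #|I| -> principal_minor A I != 0.

End Volterra.

Definition is_tournament (T : finType) (e : rel T) : Prop :=
  irreflexive e /\ forall i j, i != j -> e i j (+) e j i.

(* A cycle of length 3 automatically has distinct vertices, since a tournament
   has neither loops nor 2-cycles. *)
Definition transitive_tournament (T : finType) (e : rel T) : Prop :=
  is_tournament e /\ forall i j k, ~~ [&& e i j, e j k & e k i].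

(* The pair {i, j} is oriented from i to j if a_ij < 0 and from j to i
   otherwise; off the diagonal the two readings of a pair agree because
   a_ij = - a_ji != 0 (see [tournamentP]). *)
Definition tournament {R : realType} {m : nat} (A : 'M[R]_m) : rel 'I_m :=
  fun i j => (i != j) && (A i j < 0).

Section Soundness.
Context {R : realType} {m : nat}.
Implicit Types A : 'M[R]_m.

Lemma skewE A i j : skew_symmetric A -> A i j = - A j i.
Proof. by move=> /matrixP /(_ j i); rewrite !mxE. Qed.

Lemma volterra_simplex A (x : 'rV[R]_m) :
  skew_symmetric A -> (forall k i, -1 <= A k i <= 1) ->
  simplex x -> simplex (volterra A x).
Proof.
move=> skA bA [x1 x0]; split; last first.
  move=> k; rewrite mxE mulr_ge0 // -x1 -big_split sumr_ge0 //= => i _.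
  rewrite -[X in X + _]mul1r -mulrDl mulr_ge0 //.
  by have /andP[h _] := bA k i; rewrite -lerBlDl sub0r.
under eq_bigr do rewrite mxE mulrDr mulr1.
rewrite big_split /= x1.
set S := (X in 1 + X).
have : S = - S.
  rewrite {1}/S; under eq_bigr do rewrite mulr_sumr.
  rewrite exchange_big /S -sumrN; apply: eq_bigr => i _ /=.
  rewrite mulr_sumr -sumrN; apply: eq_bigr => j _.
  by rewrite (skewE j i skA); ring.
by move=> /eqP; rewrite -addr_eq0 -mulr2n mulrn_eq0 /= => /eqP ->; rewrite addr0.
Qed.

Lemma transversal_neq0 A i j :
  skew_symmetric A -> transversal_mx A -> i != j -> A i j != 0.
Proof.
move=> skA /(_ [set i; j]%SET) + ij; rewrite cards2 ij /= => /(_ _ isT) h.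
apply/eqP => Aij0.
have I0 : [set i; j]%SET != finset.set0
  by apply/set0Pn; exists i; rewrite !inE eqxx.
move: (h I0); rewrite /principal_minor.
set B := mxsub _ _ _.
have Aji0 : A j i = 0 by rewrite (skewE _ _ skA) Aij0 oppr0.
have Add k : A k k = 0.
  by have /eqP := skewE k k skA; rewrite -addr_eq0 -mulr2n mulrn_eq0 => /eqP.
have -> : B = 0.
  apply/matrixP => a b; rewrite !mxE.
  have := enum_valP a; have := enum_valP b; rewrite !inE.
  by move=> /orP[] /eqP-> /orP[] /eqP->.
by rewrite -(scale0r 1%:M) detZ cards2 ij exprS !mul0r eqxx.
Qed.

Lemma tournamentP A :
  skew_symmetric A -> transversal_mx A -> is_tournament (tournament A).
Proof.
move=> skA trA; split=> [i|i j ij]; first by rewrite /tournament eqxx.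
rewrite /tournament ij eq_sym ij /= (skewE j i skA) oppr_lt0.
by case: ltgtP (transversal_neq0 skA trA ij).
Qed.

End Soundness.

(* Main.v *)
Require Import Defs.
From mathcomp Require Import all_boot all_order all_algebra.
From mathcomp Require Import all_classical all_reals all_analysis.
From mathcomp Require Import ring lra.
Import Order.TTheory GRing.Theory Num.Theory.
Import numFieldNormedType.Exports.

Set Implicit Arguments.
Unset Strict Implicit.
Unset Printing Implicit Defensive.

Local Open Scope classical_set_scope.
Local Open Scope ring_scope.

(** Write [(Vx)_k = x_k (1 + d_k(x))] with [d = drift A], that is [d(x) = A x].
Each of the four properties is shown to imply the next one, cyclically.

Regular implies transitive.  A 3-cycle of the tournament is a
rock-paper-scissors game: on its face there is a point [p] whose support is the
whole face and where the drift vanishes on that face ([cycle_not_regular]).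
Start at some [x <> p] with the same support and suppose that the orbit tends to
a fixed point [q].  No coordinate of the support can have positive drift at [q],
since it would grow forever ([drift_limit_le0]); pairing with [p] and using
skew-symmetry, [sum_k p_k d_k(q) = - sum_k q_k d_k(p) = 0], so the drift at [q]
vanishes on the support, and transversality gives [q = p]
([transversal_unique]).  But the function [sum_k p_k ln x_k] does not increase
along the orbit ([log_pairing_volterra]) and has its strict maximum at [p]
([log_pairing_gibbs]), so the orbit stays away from [p].

Transitive implies ergodic.  The support of [x] contains a sink [k] of the
tournament.  The coordinate [x_k] increases along the orbit, hence converges,
so its increments tend to 0; these dominate the other coordinates, and the orbit
tends to the vertex [k], which depends only on the support ([sink_attracts]).

Ergodic implies asymptotically regular, because [x] and [V x] have the same
support.

Asymptotically regular implies regular.  By transversality a fixed point is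
determined by its support, so there are finitely many.  By compactness the orbit
is eventually close to this finite set, and its steps eventually become too
small to jump from one fixed point to another ([cvg_fixed_point]). *)

(** * Convergence of row vectors *)

Lemma cvg_rowP (R : realType) m (T : Type) (G : set_system T)
    (u : T -> 'rV[R]_m) (p : 'rV[R]_m) : Filter G ->
  u @ G --> p <-> forall i, u t 0 i @[t --> G] --> p 0 i.
Proof.
move=> FG; split=> [up i|up].
  by apply: (cvg_comp u (fun M : 'rV_m => M 0 i) up); exact: coord_continuous.
apply/cvgrPdist_lt => e e0.
have : \forall n \near G, forall i, `|p 0 i - u n 0 i| < e.
  by apply: filter_forall => i; move/cvgrPdist_lt: (up i); exact.
apply: filterS => n le_e.
rewrite /Num.norm /= mx_normrE; apply: bigmax_lt => // -[i j] _ /=.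
by rewrite ord1 !mxE.
Qed.

Lemma cvg_sumr (R : realType) (I : finType) (P : pred I) (T : Type)
    (G : set_system T) (u : I -> T -> R) (l : I -> R) : Filter G ->
  (forall i, P i -> u i t @[t --> G] --> l i) ->
  \sum_(i | P i) u i t @[t --> G] --> \sum_(i | P i) l i.
Proof. by move=> FG ul; apply: cvg_big => //; exact: add_continuous. Qed.

Lemma cvg_euclidean_norm0 (R : realType) m (u : nat -> 'rV[R]_m) :
  euclidean_norm (u n) @[n --> \oo] --> (0 : R) <-> u @ \oo --> (0 : 'rV[R]_m).
Proof.
split=> [u0|/cvg_rowP u0].
  apply/cvg_rowP => i; rewrite mxE; apply/norm_cvg0P.
  apply: (squeeze_cvgr _ (cvg_cst 0) u0); near=> n.
  rewrite normr_ge0 /= -sqrtr_sqr; apply: ler_wsqrtr.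
  by rewrite (bigD1 i) //= lerDl sumr_ge0 // => j _; rewrite sqr_ge0.
have -> : (0 : R) = Num.sqrt (\sum_(i < m) (0 : 'rV[R]_m) 0 i ^+ 2).
  by rewrite big1 ?sqrtr0 // => i _; rewrite mxE expr0n.
apply: (cvg_comp (fun n => \sum_i u n 0 i ^+ 2) (@Num.sqrt R)); last first.
  exact: sqrt_continuous.
apply: cvg_sumr => i _.
by under eq_fun do rewrite expr2; rewrite expr2; apply: cvgM; exact: u0.
Unshelve. all: by end_near. Qed.

(** * Orbits with vanishing steps and finitely many possible limits *)

Lemma finite_set_separated (R : realType) (U : normedModType R) (F : set U) :
  finite_set F ->
  exists2 d : R, 0 < d & forall p q, F p -> F q -> `|p - q| < d -> p = q.
Proof.
move=> /finite_seqP[s ->].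
exists (\big[Num.min/1]_(p <- s) \big[Num.min/1]_(q <- s | p != q) `|p - q|).
  by do 2 (apply: lt_bigmin => // ? ?); rewrite normr_gt0 subr_eq0.
move=> p q /= ps qs; apply: contraPP => /eqP pq; apply/negP; rewrite -leNgt.
by apply: (@bigmin_inf_seq _ _ _ _ _ p) => //; apply: (@bigmin_inf_seq _ _ _ _ _ q).
Qed.

Section AsymptoticRegularity.
Variables (R : realType) (U : normedModType R) (K : set U) (f : U -> U).
Variable u : nat -> U.
Hypotheses (K_compact : compact K) (f_cont : continuous f).
Hypotheses (uK : forall n, K (u n)) (uS : forall n, u n.+1 = f (u n)).
Hypothesis u_steps : u n - u n.+1 @[n --> \oo] --> (0 : U).
Let F := [set p | K p /\ f p = p].

(** The displacement [x - f x] is bounded away from 0 on the compact set of the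
points of [K] at distance at least [e] from all fixed points, so an orbit with
vanishing steps eventually stays out of that set. *)
Lemma near_fixed_points (e : R) : 0 < e ->
  \forall n \near \oo, exists2 p, F p & `|u n - p| < e.
Proof.
move=> e0.
pose g x := `|x - f x|.
have g_cont : continuous g.
  move=> x; apply: (@continuous_comp _ _ _ (fun x => x - f x)).
    by apply: continuousB; [exact: cvg_id|exact: f_cont].
  exact: norm_continuous.
pose far := \bigcap_(p in F) [set x | e <= `|x - p|].
have far_closed : closed far.
  apply: closed_bigI => p _.
  apply: (@preimage_closed _ _ (fun x => `|x - p|) [set r | e <= r]).
    move=> x _; apply: (@continuous_comp _ _ _ (fun x => x - p)).
      by apply: continuousB; [exact: cvg_id|exact: cst_continuous].
    exact: norm_continuous.
  exact: closed_ge.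
have not_far n : ~ far (u n) -> exists2 p, F p & `|u n - p| < e.
  by move=> /existsNP[p] /not_implyP[Fp /negP]; rewrite -ltNge; exists p.
have [[y Ky]|none] := pselect (K `&` far !=set0); last first.
  by near=> n; apply: not_far => un; apply: none; exists (u n).
have Kfar : compact (K `&` far) by exact: compact_closedI.
have [|c] := compact_EVT_min (ex_intro _ y Ky) Kfar (f := g).
  exact: continuous_subspaceT.
rewrite inE => -[Kc farc] cmin.
have gc : 0 < g c.
  rewrite normr_gt0 subr_eq0; apply/eqP => cf.
  by have /= := farc c (conj Kc (esym cf)); rewrite subrr normr0 leNgt e0.
move/cvgr0Pnorm_lt: u_steps => /(_ _ gc); apply: filterS => n small.
apply: not_far => farn; have := cmin (u n); rewrite inE => /(_ (conj (uK n) farn)).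
by rewrite /g -uS leNgt small.
Unshelve. all: by end_near. Qed.

(** Let [d] separate the points of [F].  Once the orbit is within [d / 3] of [F]
and its steps are shorter than [d / 3], the fixed point close to it can no longer
change. *)
Lemma cvg_fixed_point : finite_set F -> exists2 p, F p & u @ \oo --> p.
Proof.
move=> /finite_set_separated[d d0 sep].
have d3 : 0 < d / 3 by rewrite divr_gt0.
have [N _ HN] : \forall n \near \oo,
    (exists2 p, F p & `|u n - p| < d / 3) /\ `|u n - u n.+1| < d / 3.
  near=> n; split; near: n; first exact: near_fixed_points.
  by move/cvgr0Pnorm_lt: u_steps; apply.
have [[p Fp pN] _] := HN N (leqnn N).
have close n : (N <= n)%N -> `|u n - p| < d / 3.
  elim: n => [|n IH]; first by rewrite leqn0 => /eqP N0; rewrite N0 in pN.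
  rewrite leq_eqVlt => /predU1P[<- //|]; rewrite ltnS => Nn.
  have [[q Fq qn] _] := HN n.+1 (leqW Nn).
  have [_ step] := HN n Nn.
  suff -> : p = q by [].
  apply: sep => //; rewrite distrC.
  have -> : q - p = (q - u n.+1) + (u n.+1 - u n) + (u n - p).
    by rewrite !addrA !subrK.
  rewrite (le_lt_trans (ler_normD _ _)) //.
  have := ler_normD (q - u n.+1) (u n.+1 - u n).
  rewrite (distrC q) (distrC (u n.+1) (u n)) => H.
  by have := IH Nn; move: H qn step; lra.
exists p => //; apply/cvgrPdist_lt => e e0.
have e'0 : 0 < Num.min e (d / 3) by rewrite lt_min e0.
have Nnear : \forall n \near \oo, (N <= n)%N by exact: nbhs_infty_ge.
near=> n.
have Nn : (N <= n)%N by near: n.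
have [q Fq] : exists2 q, F q & `|u n - q| < Num.min e (d / 3).
  by near: n; exact: near_fixed_points.
rewrite lt_min => /andP[qe qd].
suff -> : p = q by rewrite distrC.
apply: sep => //.
have -> : p - q = (p - u n) + (u n - q) by rewrite addrA subrK.
rewrite (le_lt_trans (ler_normD _ _)) // (distrC p).
by have := close n Nn; move: qd; lra.
Unshelve. all: by end_near. Qed.

End AsymptoticRegularity.

(** * The simplex *)

Lemma simplex_le1 (R : realType) m (x : 'rV[R]_m) i : simplex x -> x 0 i <= 1.
Proof.
by move=> [<- x0]; rewrite (bigD1 i) //= lerDl sumr_ge0.
Qed.

Lemma simplex_compact (R : realType) m : compact (@simplex R m).
Proof.
have box : compact [set v : 'rV[R]_m | forall i, `[0 : R, 1]%classic (v ord0 i)].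
  by apply: (@rV_compact R m (fun=> `[0, 1]%classic)) => i; exact: segment_compact.
have sum_closed : closed [set v : 'rV[R]_m | \sum_i v 0 i = 1].
  apply: (@preimage_closed _ _ (fun v : 'rV[R]_m => \sum_i v 0 i) [set 1]).
    by move=> v _; apply: (@cvg_sumr _ _ _ _ (nbhs v)) => i _; exact: coord_continuous.
  exact: closed_eq.
have -> : @simplex R m = [set v | forall i, `[0 : R, 1]%classic (v ord0 i)] `&`
    [set v | \sum_i v 0 i = 1].
  apply/seteqP; split => [x Sx|x [x01 x1]]; last first.
    by split=> // i; have := x01 i; rewrite /= in_itv /= => /andP[].
  split; last by case: Sx.
  by move=> i /=; rewrite in_itv /= simplex_le1 // andbT; case: Sx.
exact: compact_closedI.
Qed.

(** * Drift and equilibria of a skew-symmetric matrix *)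

Definition drift (R : realType) m (A : 'M[R]_m) (x : 'rV[R]_m) (k : 'I_m) : R :=
  \sum_i A k i * x 0 i.

Section Drift.
Context {R : realType} {m : nat}.
Implicit Types (A : 'M[R]_m) (x p q : 'rV[R]_m).

Lemma volterraE A x k : volterra A x 0 k = x 0 k * (1 + drift A x k).
Proof. by rewrite mxE. Qed.

Lemma drift_skew A p q : skew_symmetric A ->
  \sum_k p 0 k * drift A q k = - \sum_k q 0 k * drift A p k.
Proof.
move=> skA; rewrite -sumrN.
under eq_bigr do rewrite mulr_sumr.
rewrite exchange_big; apply: eq_bigr => i _ /=.
rewrite mulr_sumr -sumrN; apply: eq_bigr => j _.
by rewrite (skewE j i skA); ring.
Qed.

Lemma drift_continuous A k : continuous (fun x => drift A x k).
Proof.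
move=> x; apply: (@cvg_sumr _ _ _ _ (nbhs x)) => i _.
by apply: cvgM; [exact: cvg_cst|exact: coord_continuous].
Qed.

Lemma volterra_continuous A : continuous (volterra A).
Proof.
move=> x; apply/(@cvg_rowP _ _ _ (nbhs x)) => i.
under eq_fun do rewrite volterraE; rewrite volterraE.
apply: cvgM; first exact: coord_continuous.
by apply: cvgD; [exact: cvg_cst|exact: drift_continuous].
Qed.

Lemma in_supp x i : (i \in supp x) = (x 0 i != 0).
Proof. by rewrite inE. Qed.

Lemma simplex_supp_gt0 x i : simplex x -> (i \in supp x) = (0 < x 0 i).
Proof. by move=> [_ x0]; rewrite in_supp lt_def x0 andbT. Qed.

Lemma simplex_supp_neq0 x : simplex x -> exists i, i \in supp x.
Proof.
move=> [x1 _]; apply/existsP; rewrite -[X in is_true X]negbK negb_exists.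
apply/negP => /forallP h.
have : \sum_i x 0 i = 0.
  by apply: big1 => i _; apply/eqP; rewrite -[_ == _]negbK -in_supp h.
by rewrite x1 => /eqP; rewrite oner_eq0.
Qed.

Lemma sum_supp x : simplex x -> \sum_(i in supp x) x 0 i = 1.
Proof.
move=> [x1 _]; rewrite -[RHS]x1 [RHS](bigID (mem (supp x))) /=.
rewrite [X in _ = _ + X]big1 ?addr0 // => i.
by rewrite in_supp negbK => /eqP.
Qed.

Lemma fixed_drift A p k : volterra A p = p -> k \in supp p -> drift A p k = 0.
Proof.
move=> /rowP/(_ k); rewrite volterraE in_supp mulrDr mulr1 => /eqP.
by rewrite addrC -subr_eq0 addrK mulf_eq0 => /orP[->//|/eqP].
Qed.

(** The entries of [x] indexed by [J] form a vector killed by the principal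
submatrix on [J], which transversality makes invertible. *)
Lemma drift_ker A (J : {set 'I_m}) x : transversal_mx A -> ~~ odd #|J| ->
  {subset supp x <= J} -> {in J, forall k, drift A x k = 0} -> x = 0.
Proof.
move=> trA evenJ xJ dJ.
have [J0|Jn0] := eqVneq J finset.set0.
  apply/rowP => i; rewrite mxE; apply/eqP; rewrite -[_ == _]negbK -in_supp.
  by apply/negP => /xJ; rewrite J0 inE.
have := trA J Jn0 evenJ; rewrite /principal_minor; set B := mxsub _ _ _ => detB.
pose v : 'cV[R]_#|J| := \col_a x 0 (enum_val a).
have Bv : B *m v = 0.
  apply/colP => a; rewrite !mxE -[RHS](dJ _ (enum_valP a)) /drift.
  rewrite [RHS](bigID (mem J)) /= [X in _ = _ + X]big1 ?addr0; last first.
    move=> i iJ; suff -> : x 0 i = 0 by rewrite mulr0.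
    by apply/eqP; rewrite -[_ == _]negbK -in_supp; apply: contra iJ => /xJ.
  rewrite [RHS]big_enum_val /=.
  by apply: eq_bigr => b _; rewrite !mxE.
have Bu : B \in unitmx by rewrite unitmxE unitfE.
have v0 : v = 0 by rewrite -(mulKmx Bu v) Bv mulmx0.
apply/rowP => i; rewrite mxE; apply/eqP; rewrite -[_ == _]negbK -in_supp.
apply/negP => ix; have iJ := xJ _ ix; move: ix; rewrite in_supp.
have /colP/(_ (enum_rank_in iJ i)) := v0.
by rewrite !mxE enum_rankK_in // => ->; rewrite eqxx.
Qed.

(** The nonzero vector [p] is killed by the principal submatrix on [supp p], so
[drift_ker] forces [#|supp p|] to be odd.  The combination [p_k q - q_k p]
vanishes at [k], hence lives on the even set [supp p] minus [k], where
[drift_ker] makes it zero: [q] is proportional to [p]. *)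
Lemma transversal_unique A p q : transversal_mx A -> simplex p -> simplex q ->
  {subset supp q <= supp p} -> {in supp p, forall k, drift A p k = 0} ->
  {in supp p, forall k, drift A q k = 0} -> q = p.
Proof.
move=> trA Sp Sq qp dp dq.
have [k kp] := simplex_supp_neq0 Sp.
have odd_p : odd #|supp p|.
  apply: contraTT kp => ev; rewrite in_supp negbK.
  by rewrite (drift_ker trA ev (fun _ => id) dp) mxE.
have w0 : p 0 k *: q - q 0 k *: p = 0.
  apply: (@drift_ker A (supp p :\ k)%SET) => //.
  - by move: odd_p; rewrite (cardsD1 k) kp.
  - move=> i; rewrite in_supp in_setD1 !mxE; have [->|ik] := eqVneq i k.
      by rewrite mulrC subrr eqxx.
    apply: contraNT => /=; rewrite in_supp negbK => /eqP pi0.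
    suff -> : q 0 i = 0 by rewrite pi0 !mulr0 subrr.
    apply/eqP; rewrite -[_ == _]negbK -in_supp; apply/negP => /qp.
    by rewrite in_supp pi0 eqxx.
  - move=> i; rewrite in_setD1 => /andP[_ ip].
    rewrite /drift; under eq_bigr do rewrite !mxE mulrBr !(mulrCA (A _ _)).
    rewrite sumrB -!mulr_sumr -/(drift A p i) -/(drift A q i).
    by rewrite dp // dq // !mulr0 subrr.
have prop i : p 0 k * q 0 i = q 0 k * p 0 i.
  by have /rowP/(_ i) := w0; rewrite !mxE => /eqP; rewrite subr_eq0 => /eqP.
have pq : p 0 k = q 0 k.
  have : \sum_i p 0 k * q 0 i = \sum_i q 0 k * p 0 i by apply: eq_bigr.
  by rewrite -!mulr_sumr; case: Sp => -> _; case: Sq => -> _; rewrite !mulr1.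
apply/rowP => i; apply: (@mulfI _ (p 0 k)); first by rewrite -in_supp.
by rewrite prop pq.
Qed.

End Drift.

Lemma ln_lt_sub1 (R : realType) (t : R) : 0 < t -> t != 1 -> ln t < t - 1.
Proof.
move=> t0 t1; rewrite ltrBrDl -{2}(lnK t0); apply: expR_gt1Dx.
by rewrite ln_eq0.
Qed.

(** * Trajectories of a Volterra operator *)

Section Trajectories.
Context {R : realType} {m : nat} (A : 'M[R]_m).
Hypothesis skA : skew_symmetric A.
Hypothesis bA : forall k i, -1 <= A k i <= 1.
Implicit Types (x p q : 'rV[R]_m).
Local Notation V := (volterra A).

(** Since [sum_i x_i = 1] and [A k k = 0], [1 + drift A x k] is [x_k] plus a sum of
nonnegative terms [(1 + A k i) x_i]; this holds even if entries of [A] equal -1,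
so that [V] preserves supports. *)
Lemma drift_gtN1 x k : simplex x -> 0 < x 0 k -> -1 < drift A x k.
Proof.
move=> [x1 x0] xk; rewrite -subr_gt0 opprK addrC -x1 /drift -big_split /=.
rewrite (bigD1 k) //= ltr_wpDr //.
  rewrite sumr_ge0 // => i _; rewrite -[X in X + _]mul1r -mulrDl mulr_ge0 //.
  by have /andP[h _] := bA k i; lra.
have := skewE k k skA => Akk.
have -> : A k k = 0 by lra.
by rewrite mul0r addr0.
Qed.

Lemma volterra_supp x : simplex x -> supp (V x) = supp x.
Proof.
move=> Sx; apply/setP => k; rewrite !in_supp volterraE mulf_eq0 negb_or.
have [//|xk] := eqVneq (x 0 k) 0 => /=.
have : 0 < x 0 k by rewrite -simplex_supp_gt0 // in_supp.
by move=> /(drift_gtN1 Sx) h; rewrite gt_eqF //; lra.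
Qed.

Lemma iter_simplex n x : simplex x -> simplex (iter n V x).
Proof. by move=> Sx; elim: n => //= n; exact: volterra_simplex. Qed.

Lemma iter_supp n x : simplex x -> supp (iter n V x) = supp x.
Proof.
by move=> Sx; elim: n => //= n <-; rewrite volterra_supp //; exact: iter_simplex.
Qed.

Lemma iter_gt0 n x k : simplex x -> k \in supp x -> 0 < iter n V x 0 k.
Proof.
move=> Sx; rewrite -(iter_supp n Sx) simplex_supp_gt0 //.
exact: iter_simplex.
Qed.

(** A positive drift at [q] would make the positive coordinate [k] eventually
nondecreasing, whence [q_k > 0]; but at a fixed point the drift vanishes on the
support. *)
Lemma drift_limit_le0 x q k : simplex x -> k \in supp x ->
  iter n V x @[n --> \oo] --> q -> V q = q -> drift A q k <= 0.
Proof.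
move=> Sx kx xq qfix; rewrite leNgt; apply/negP => dq.
have dx : drift A (iter n V x) k @[n --> \oo] --> drift A q k.
  by apply: (cvg_comp (fun n => iter n V x) (fun y => drift A y k) xq);
     exact: drift_continuous.
have [N _ HN] : \forall n \near \oo, 0 < drift A (iter n V x) k.
  by move/cvgr_gt: dx; apply.
have grow n : (N <= n)%N -> iter N V x 0 k <= iter n V x 0 k.
  elim: n => [|n IH]; first by rewrite leqn0 => /eqP ->.
  rewrite leq_eqVlt => /predU1P[<- //|]; rewrite ltnS => Nn.
  apply: le_trans (IH Nn) _; rewrite [iter n.+1 _ _]/= volterraE.
  apply: ler_peMr; first by rewrite ltW ?iter_gt0.
  by rewrite lerDl ltW //; exact: HN.
have qk : 0 < q 0 k.
  apply: lt_le_trans (iter_gt0 N Sx kx) _.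
  have /cvg_rowP/(_ k) xqk := xq.
  apply: (cvgr_to_ge xqk); exists N => // n Nn; exact: grow.
have : k \in supp q by rewrite in_supp gt_eqF.
by move=> /(fixed_drift qfix) d0; move: dq; rewrite d0 ltxx.
Qed.

Lemma limit_supp x q : simplex x ->
  iter n V x @[n --> \oo] --> q -> {subset supp q <= supp x}.
Proof.
move=> Sx /cvg_rowP xq k; apply: contraTT => kx; rewrite in_supp negbK.
have -> : q 0 k = 0; last by [].
apply: (cvg_unique _ (xq k)) => //.
have -> : (fun n => iter n V x 0 k) = (fun=> 0).
  apply/funext => n; apply/eqP; rewrite -[_ == _]negbK -in_supp.
  by rewrite iter_supp.
exact: cvg_cst.
Qed.

(** The logarithm of the classical Lyapunov function, the product of the
[x_k ^ p_k]. *)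
Definition log_pairing p x : R := \sum_(k in supp p) p 0 k * ln (x 0 k).

(** By [ln (1 + t) <= t] the increment is at most [sum_k p_k drift A x k], which is
zero by skew-symmetry because the drift at [p] vanishes on the support of [x]. *)
Lemma log_pairing_volterra p x : simplex p -> simplex x -> supp x = supp p ->
  {in supp p, forall k, drift A p k = 0} ->
  log_pairing p (V x) <= log_pairing p x.
Proof.
move=> Sp Sx xp dp.
have xpos k : k \in supp p -> 0 < x 0 k by rewrite -xp simplex_supp_gt0.
rewrite -subr_le0 /log_pairing -sumrB.
apply: (@le_trans _ _ (\sum_(k in supp p) p 0 k * drift A x k)).
  apply: ler_sum => k kp; rewrite -mulrBr volterraE.
  have dk := drift_gtN1 Sx (xpos k kp).
  rewrite lnM ?posrE ?xpos //; last by lra.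
  rewrite addrC addrA (addrC (- _)) subrr add0r.
  rewrite ler_wpM2l ?le_ln1Dx //; by case: Sp.
have -> : \sum_(k in supp p) p 0 k * drift A x k = \sum_k p 0 k * drift A x k.
  rewrite [RHS](bigID (mem (supp p))) /= [X in _ = _ + X]big1 ?addr0 // => k.
  by rewrite in_supp negbK => /eqP ->; rewrite mul0r.
rewrite drift_skew // big1 ?oppr0 // => k _.
have [kp|] := boolP (k \in supp p); first by rewrite dp // mulr0.
by rewrite -xp in_supp negbK => /eqP ->; rewrite mul0r.
Qed.

(** Gibbs' inequality: sum [p_k ln (x_k / p_k) <= x_k - p_k] over the support,
strictly where [x_k <> p_k]. *)
Lemma log_pairing_gibbs p x : simplex p -> simplex x -> supp x = supp p ->
  x != p -> log_pairing p x < log_pairing p p.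
Proof.
move=> Sp Sx xp xnp.
have ppos k : k \in supp p -> 0 < p 0 k by rewrite simplex_supp_gt0.
have xpos k : k \in supp p -> 0 < x 0 k by rewrite -xp simplex_supp_gt0.
have termE k : k \in supp p ->
    p 0 k * ln (x 0 k) - p 0 k * ln (p 0 k) = p 0 k * ln (x 0 k / p 0 k).
  by move=> kp; rewrite -mulrBr ln_div ?posrE ?xpos ?ppos.
have boundE k : k \in supp p -> p 0 k * (x 0 k / p 0 k - 1) = x 0 k - p 0 k.
  by move=> kp; rewrite mulrBr mulr1 mulrC divfK // gt_eqF ?ppos.
have [k kp xk] : exists2 k, k \in supp p & x 0 k != p 0 k.
  have /existsP[k] : [exists k, x 0 k != p 0 k].
    rewrite -[X in is_true X]negbK negb_exists; apply: contra xnp.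
    by move=> /forallP h; apply/eqP/rowP => k; apply/eqP; rewrite -[_ == _]negbK h.
  move=> xk; exists k => //; apply: contraNT xk => kp; move: (kp).
  rewrite {1}in_supp negbK => /eqP ->.
  by move: kp; rewrite -xp in_supp negbK => /eqP ->.
have zero : \sum_(k in supp p) (x 0 k - p 0 k) = 0.
  by rewrite sumrB sum_supp // -xp sum_supp // subrr.
rewrite -subr_lt0 /log_pairing -sumrB -[ltRHS]zero (bigD1 k) //= [ltRHS](bigD1 k) //=.
apply: ltr_leD.
  rewrite termE // -boundE // ltr_pM2l ?ppos //.
  apply: ln_lt_sub1; first by rewrite divr_gt0 ?xpos ?ppos.
  apply: contra xk => /eqP ratio1.
  by rewrite -(divfK (lt0r_neq0 (ppos k kp)) (x 0 k)) ratio1 mul1r.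
apply: ler_sum => i /andP[ip _]; rewrite termE // -boundE //.
apply: ler_wpM2l; first exact: ltW (ppos i ip).
have := @le_ln1Dx R (x 0 i / p 0 i - 1); rewrite addrCA subrr addr0; apply.
by rewrite ltrBrDl subrr divr_gt0 ?xpos ?ppos.
Qed.

Lemma not_cvg_equilibrium p x : simplex p -> simplex x -> supp x = supp p ->
  x != p -> {in supp p, forall k, drift A p k = 0} ->
  ~ (iter n V x @[n --> \oo] --> p).
Proof.
move=> Sp Sx xp xnp dp /cvg_rowP cvgp.
have decr n : log_pairing p (iter n V x) <= log_pairing p x.
  elim: n => //= n; apply: le_trans; apply: log_pairing_volterra => //.
    exact: iter_simplex.
  by rewrite iter_supp.
have lim : log_pairing p (iter n V x) @[n --> \oo] --> log_pairing p p.
  apply: cvg_sumr => k kp; apply: cvgM; first exact: cvg_cst.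
  apply: (cvg_comp (fun n => iter n V x 0 k) (@ln R) (cvgp k)).
  by apply: continuous_ln; rewrite -simplex_supp_gt0.
have : log_pairing p p <= log_pairing p x.
  by apply: (cvgr_to_le lim); near=> n; exact: decr.
by rewrite leNgt log_pairing_gibbs.
Unshelve. all: by end_near. Qed.

(** An orbit starting elsewhere in the relative interior of the face of [p] has no
possible limit: such a limit would have to be [p], which
[not_cvg_equilibrium] excludes. *)
Lemma equilibrium_not_regular p : transversal_mx A -> simplex p -> (1 < #|supp p|)%N ->
  {in supp p, forall k, drift A p k = 0} -> ~ regular V.
Proof.
move=> trA Sp p2 dp reg.
have [k kp] := simplex_supp_neq0 Sp.
(* the midpoint of [p] and the vertex [k] *)
pose x : 'rV[R]_m := \row_i ((p 0 i + (i == k)%:R) / 2).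
have Sx : simplex x.
  case: Sp => p1 p0; split=> [|i]; last by rewrite mxE divr_ge0 // addr_ge0.
  under eq_bigr do rewrite mxE; rewrite -mulr_suml big_split /= p1.
  rewrite (bigD1 k) //= eqxx big1 ?addr0; last by move=> i /negPf ->.
  by rewrite divff.
have xp : supp x = supp p.
  apply/setP => i; rewrite !simplex_supp_gt0 // mxE.
  have [->|ik] := eqVneq i k; last by rewrite addr0 pmulr_lgt0 ?invr_gt0.
  have pk : 0 < p 0 k by rewrite -simplex_supp_gt0.
  by rewrite pk divr_gt0 // addr_gt0.
have xnp : x != p.
  have [j jk] : exists2 j, j \in supp p & j != k.
    have /card_gt1P[a [b [ap bp ab]]] := p2.
    by have [ak|] := eqVneq a k; [exists b => //; rewrite -ak eq_sym|exists a].
  move=> jnk; apply/eqP => /rowP/(_ j); rewrite mxE (negPf jnk) addr0 => /eqP.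
  rewrite -subr_eq0.
  have -> : p 0 j / 2 - p 0 j = - (p 0 j / 2) by field.
  by rewrite oppr_eq0 mulf_eq0 invr_eq0 pnatr_eq0 orbF; apply/negP; rewrite -in_supp.
have [q [Sq qfix xq]] := reg x Sx.
suff qp : q = p by move: xq; rewrite qp; exact: not_cvg_equilibrium.
have qsupp : {subset supp q <= supp p} by rewrite -xp; exact: limit_supp xq.
apply: (transversal_unique trA) => //.
have dq i : i \in supp p -> drift A q i <= 0.
  by rewrite -xp => ix; exact: drift_limit_le0 xq qfix.
(* a sum of nonnegative terms equal to zero, so that each term vanishes *)
have : \sum_i p 0 i * - drift A q i = 0.
  under eq_bigr do rewrite mulrN; rewrite sumrN drift_skew // opprK.
  apply: big1 => i _; have [ip|] := boolP (i \in supp p).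
    by rewrite dp // mulr0.
  move=> ip; have : i \notin supp q by apply: contra ip; exact: qsupp.
  by rewrite in_supp negbK => /eqP ->; rewrite mul0r.
have terms i : true -> 0 <= p 0 i * - drift A q i.
  move=> _; have [ip|] := boolP (i \in supp p).
    by rewrite mulr_ge0 ?oppr_ge0 ?dq //; case: Sp.
  by rewrite in_supp negbK => /eqP ->; rewrite mul0r.
move=> /(psumr_eq0P terms) h i ip; have := h i isT; move=> /eqP.
rewrite mulf_eq0 oppr_eq0 => /orP[|/eqP //].
by move: ip; rewrite in_supp => /negPf ->.
Qed.

End Trajectories.

(** * Consequences of transitivity and of 3-cycles *)

(** A vertex of [S] with the most predecessors in [S] is a sink: by transitivity a
successor [i] of [k] would have [k] and all the predecessors of [k] as
predecessors. *)
Lemma transitive_tournament_sink (T : finType) (e : rel T) (S : {set T}) i0 :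
  transitive_tournament e -> i0 \in S ->
  exists2 k, k \in S & {in S, forall i, i != k -> e i k}.
Proof.
move=> [[irr tot] trans] i0S.
pose indeg k := #|[set i in S | e i k]%SET|.
case: (@arg_maxnP _ i0 (mem S) indeg i0S) => k /= kS kmax; exists k => // i iS ik.
have := tot _ _ ik; case eik: (e i k) => //= eki.
have := kmax i iS; rewrite /= leqNgt => /negP[].
apply: proper_card; apply/properP; split.
  apply/fintype.subsetP => j; rewrite !inE => /andP[jS ejk]; rewrite jS /=.
  have [ji|ji] := eqVneq j i; first by rewrite ji eik in ejk.
  have := tot _ _ ji; case: (e j i) => //= eij.
  by have := trans i j k; rewrite eij ejk eki.
by exists k; rewrite !inE (kS : k \in S) ?eki // irr.
Qed.

Section Equivalence.
Context {R : realType} {m : nat} (A : 'M[R]_m).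
Hypothesis skA : skew_symmetric A.
Hypothesis bA : forall k i, -1 <= A k i <= 1.
Hypothesis trA : transversal_mx A.
Implicit Types (x p q : 'rV[R]_m).
Local Notation V := (volterra A).

(** On the face of the 3-cycle, the kernel of the 3 x 3 skew-symmetric submatrix is
spanned by [(a_jk, a_ki, a_ij)], whose entries have the same sign; normalized,
it is an equilibrium with full support on the face. *)
Lemma cycle_not_regular i j k : tournament A i j -> tournament A j k ->
  tournament A k i -> ~ regular V.
Proof.
move=> /andP[ij Aij] /andP[jk Ajk] /andP[ki Aki].
have Add l : A l l = 0 by have := skewE l l skA; lra.
have s0 : 0 < - A i j - A j k - A k i by lra.
pose s := - A i j - A j k - A k i.
pose w l : R := if l == i then - A j k else if l == j then - A k i
  else if l == k then - A i j else 0.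
pose p : 'rV[R]_m := \row_l (w l / s).
have wi : w i = - A j k by rewrite /w eqxx.
have wj : w j = - A k i by rewrite /w eq_sym (negPf ij) eqxx.
have wk : w k = - A i j by rewrite /w (negPf ki) eq_sym (negPf jk) eqxx.
have wsum (f : 'I_m -> R) :
    \sum_l f l * w l = f i * w i + f j * w j + f k * w k.
  rewrite (bigD1 i) //= (bigD1 j) 1?eq_sym //= (bigD1 k) /=; last first.
    by rewrite ki eq_sym.
  rewrite big1 ?addr0 ?addrA // => l /andP[/andP[li lj] lk].
  by rewrite /w (negPf li) (negPf lj) (negPf lk) mulr0.
have w_ge0 l : 0 <= w l.
  by rewrite /w; do 3 (case: ifP => _; first by lra).
have suppP l : (l \in supp p) = (l \in [set i; j; k]%SET).
  rewrite in_supp mxE mulf_eq0 invr_eq0 (gt_eqF s0) orbF !inE /w.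
  case: (l == i); first by rewrite gt_eqF // oppr_gt0.
  case: (l == j); first by rewrite gt_eqF // oppr_gt0.
  by case: (l == k); [rewrite gt_eqF // oppr_gt0|rewrite eqxx].
apply: (@equilibrium_not_regular _ _ A skA bA p) => //.
- split=> [|l]; last by rewrite mxE divr_ge0 // ltW.
  under eq_bigr do rewrite mxE; rewrite -mulr_suml.
  have := wsum (fun=> 1); under eq_bigr do rewrite mul1r.
  move=> ->; rewrite wi wj wk !mul1r.
  have -> : - A j k + - A k i + - A i j = s by rewrite /s; ring.
  by rewrite divff // gt_eqF.
- by apply/card_gt1P; exists i, j; rewrite !suppP !inE !eqxx ?orbT.
- move=> l; rewrite suppP !inE => lS.
  rewrite /drift; under eq_bigr do rewrite mxE mulrA; rewrite -mulr_suml wsum.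
  rewrite wi wj wk.
  suff -> : A l i * - A j k + A l j * - A k i + A l k * - A i j = 0.
    by rewrite mul0r.
  have Eji := skewE j i skA; have Ekj := skewE k j skA; have Eik := skewE i k skA.
  by case/orP: lS => [/orP[]|] /eqP ->; rewrite Add ?Eji ?Ekj ?Eik; ring.
Qed.

Lemma regular_transitive : regular V -> transitive_tournament (tournament A).
Proof.
move=> reg; split; first exact: tournamentP.
move=> i j k; apply/and3P => -[eij ejk eki].
exact: cycle_not_regular eij ejk eki reg.
Qed.

(** The increment of the coordinate [k] is at least [x_k a_ki u_i] for each [i],
where [x_k > 0] is the initial value and [u] the current point; as [u_k] is
bounded and nondecreasing these increments tend to 0, and so does [u_i]. *)
Lemma sink_attracts x k : simplex x -> k \in supp x ->
  {in supp x, forall i, i != k -> 0 < A k i} ->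
  iter n V x @[n --> \oo] --> (delta_mx 0 k : 'rV[R]_m).
Proof.
move=> Sx kx Ak.
pose u n := iter n V x.
have Su n : simplex (u n) by exact: iter_simplex.
have u0 n i : 0 <= u n 0 i by have [_] := Su n; exact.
have uout n i : i \notin supp x -> u n 0 i = 0.
  by rewrite -(iter_supp skA bA n Sx) in_supp negbK => /eqP.
have Akk : A k k = 0 by have := skewE k k skA; lra.
have term0 n i : 0 <= A k i * u n 0 i.
  have [->|ik] := eqVneq i k; first by rewrite Akk mul0r.
  have [ix|ix] := boolP (i \in supp x); last by rewrite uout // mulr0.
  by rewrite mulr_ge0 // ltW // Ak.
have step n i : u n 0 k * (A k i * u n 0 i) <= u n.+1 0 k - u n 0 k.
  rewrite [u n.+1]/= volterraE mulrDr mulr1 addrAC subrr add0r.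
  apply: ler_wpM2l => //.
  by rewrite /drift (bigD1 i) //= lerDl sumr_ge0.
have mono : nondecreasing_seq (fun n => u n 0 k).
  apply/nondecreasing_seqP => n; rewrite -subr_ge0; apply: le_trans (step n k).
  by rewrite mulr_ge0.
have ucvg : cvgn (fun n => u n 0 k).
  apply: nondecreasing_is_cvgn mono _.
  by exists 1 => _ [n _ <-]; apply: simplex_le1.
have incr0 : u n.+1 0 k - u n 0 k @[n --> \oo] --> (0 : R).
  rewrite -[X in _ --> X](subrr (limn (fun n => u n 0 k))).
  by apply: cvgB => //; rewrite (cvg_shiftS (fun n => u n 0 k)).
have xk0 : 0 < x 0 k by rewrite -simplex_supp_gt0.
have others i : i != k -> u n 0 i @[n --> \oo] --> (0 : R).
  move=> ik; have [ix|ix] := boolP (i \in supp x); last first.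
    by under eq_fun do rewrite uout //; exact: cvg_cst.
  have c0 : 0 < x 0 k * A k i by rewrite mulr_gt0 // Ak.
  have bound0 : (x 0 k * A k i)^-1 * (u n.+1 0 k - u n 0 k) @[n --> \oo] --> (0 : R).
    by rewrite -[X in _ --> X](mulr0 (x 0 k * A k i)^-1); apply: cvgMl_tmp.
  apply: (squeeze_cvgr _ (cvg_cst 0) bound0); near=> n.
  rewrite u0 /= mulrC ler_pdivlMr // mulrC -mulrA.
  apply: le_trans (step n i); apply: ler_wpM2r => //.
  exact: (mono 0%N n).
apply/cvg_rowP => i; rewrite mxE eqxx /=.
have [->|ik] := eqVneq i k; last exact: others.
have -> : (fun n => u n 0 k) = (fun n => 1 - \sum_(i | i != k) u n 0 i).
  by apply/funext => n; have [<- _] := Su n; rewrite (bigD1 k) //= addrK.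
rewrite -[X in _ --> X](subr0 1); apply: cvgB; first exact: cvg_cst.
have sum0 : \sum_(i < m | i != k) (0 : R) = 0 by exact: big1.
have := @cvg_sumr _ _ _ _ \oo (fun i n => u n 0 i) (fun=> 0) _ others.
by rewrite sum0; apply.
Unshelve. all: by end_near. Qed.

Lemma transitive_ergodic :
  transitive_tournament (tournament A) -> ergodic_principle V.
Proof.
move=> tT x y Sx Sy xy; apply/cvg_euclidean_norm0.
have [i0 i0x] := simplex_supp_neq0 Sx.
have [k kx ksink] := transitive_tournament_sink tT i0x.
have Ak : {in supp x, forall i, i != k -> 0 < A k i}.
  move=> i ix ik; have /andP[_] := ksink i ix ik.
  by rewrite (skewE i k skA) oppr_lt0.
rewrite -(subrr (delta_mx 0 k : 'rV[R]_m)); apply: cvgB; first exact: sink_attracts.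
by apply: sink_attracts; rewrite -?xy.
Qed.

Lemma ergodic_asymptotically_regular :
  ergodic_principle V -> asymptotically_regular V.
Proof.
move=> erg x Sx; under eq_fun do rewrite iterSr.
apply: erg => //; first exact: volterra_simplex.
by rewrite volterra_supp.
Qed.

(** By [transversal_unique] a fixed point is determined by its support. *)
Lemma finite_fixed_points : finite_set [set p | simplex p /\ V p = p].
Proof.
have supp_inj p q : simplex p /\ V p = p -> simplex q /\ V q = q ->
    supp p = supp q -> p = q.
  move=> [Sp Vp] [Sq Vq] pq; apply: (transversal_unique trA Sq Sp).
  - by rewrite pq.
  - by move=> k kq; apply: fixed_drift.
  - by move=> k kq; apply: fixed_drift; rewrite ?pq.
(* [c I] is the fixed point of support [I]; the default 0 is taken when there is
   none *)
pose c I := xget 0 [set p | (simplex p /\ V p = p) /\ supp p = I].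
apply: (@sub_finite_set _ _ (c @` setT)); last first.
  by apply: finite_image; exact: finite_finset.
move=> p Fp; exists (supp p) => //; rewrite /c.
by case: xgetP => [q _ [Fq qp]|/(_ p)/(_ (conj Fp erefl))[]]; exact: supp_inj.
Qed.

Lemma asymptotically_regular_regular :
  asymptotically_regular V -> regular V.
Proof.
move=> asym x Sx.
have steps : iter n V x - iter n.+1 V x @[n --> \oo] --> (0 : 'rV[R]_m).
  by apply/cvg_euclidean_norm0; exact: asym.
have [p [Sp Vp] xp] := cvg_fixed_point (@simplex_compact R m)
  (@volterra_continuous R m A) (fun n => iter_simplex skA bA n Sx) (fun=> erefl) steps
  finite_fixed_points.
by exists p.
Qed.

End Equivalence.
Unset Implicit Arguments.

Theorem mainTheorem1 (R : realType) (m : nat) (A : 'M[R]_m)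
    (m_gt0 : (0 < m)%N)
    (A_skew : skew_symmetric A)
    (A_bound : forall k i : 'I_m, -1 <= A k i <= 1)
    (A_transversal : transversal_mx A) :
  [<-> regular (volterra A);
       transitive_tournament (tournament A);
       ergodic_principle (volterra A);
       asymptotically_regular (volterra A)].
Proof.
tfae.
- exact: regular_transitive.
- exact: transitive_ergodic.
- exact: ergodic_asymptotically_regular.
- exact: asymptotically_regular_regular.
Qed.
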